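(* Let $p\ge2$, $\mu>0$, $b>0$, and suppose that the multivariate statistic $\theta:\mathcal X^n\to\mathbb R^p$ is a frequency table. The multivariate Laplace mechanism $M_{\mathrm{Lap}}(\cdot;b)$ perturbing $\theta$ is $\mu$-GDP if and only if $b\ge\tilde b_\mu$, where $$\tilde b_\mu=\inf\{b>0:\ \mathcal L_{\mathrm{freq}}(b)\ge G_\mu\},\qquad \mathcal L_{\mathrm{freq}}(b)=T\big(\mathrm{Lap}_2((0,0)^\top,b),\ \mathrm{Lap}_2((1,1)^\top,b)\big).$$
   Context: Frequency table: the sample space $\mathcal X$ is partitioned into $p$ (nonempty) categories $C_1,\dots,C_p$, $n\ge1$, and for $S=(x_1,\dots,x_n)\in\mathcal X^n$, $\theta(S)=(\theta_1(S),\dots,\theta_p(S))^\top$ with $\theta_i(S)=\#\{j:x_j\in C_i\}$. $S,S'\in\mathcal X^n$ are neighbors ($S\sim S'$) if they differ in exactly one record. $\mathrm{Lap}(\delta,b)$ is the Laplace distribution with location $\delta\in\mathbb R$ and scale $b>0$ (density $\frac1{2b}e^{-|x-\delta|/b}$); $\mathrm{Lap}_p(\delta,b)$, $\delta\in\mathbb R^p$, is the law of a vector with independent coordinates $X_i\sim\mathrm{Lap}(\delta_i,b)$. $M_{\mathrm{Lap}}(S;b)=\theta(S)+\mathrm{Lap}_p(0,b)$, i.e. $\theta(S)$ plus a $\mathrm{Lap}_p(0,b)$ random vector. For distributions $P,Q$ on a common space, $T(P,Q)(\alpha)=\inf\{1-\mathbb E_Q\phi:\ \phi\text{ a }[0,1]\text{-valued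 measurable test},\ \mathbb E_P\phi\le\alpha\}$, $\alpha\in[0,1]$; for random elements $T(X,Y)$ is the trade-off function of their laws. $G_\mu(\alpha)=T(N(0,1),N(\mu,1))(\alpha)=\Phi(\Phi^{-1}(1-\alpha)-\mu)$, with $\Phi$ the standard normal distribution function. Inequalities between trade-off functions are pointwise on $[0,1]$. A mechanism $M$ is $\mu$-GDP if $\inf_{S\sim S'}T(M(S),M(S'))\ge G_\mu$. *)

(* Defs.v *)
From HB Require Import structures.
From mathcomp Require Import all_boot all_order all_algebra.
From mathcomp Require Import all_classical all_reals all_analysis.
From mathcomp Require Import measurable_realfun ring.

Set Implicit Arguments.
Unset Strict Implicit.
Unset Printing Implicit Defensive.

Import Order.TTheory GRing.Theory Num.Theory.
Import numFieldNormedType.Exports.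

Local Open Scope classical_set_scope.
Local Open Scope ring_scope.

Section laplace_pdf.
Context {R : realType}.
Notation leb := (@lebesgue_measure R).
Implicit Types (delta : R) (b : {posnum R}).

Definition laplace_pdf delta b (x : R) : R :=
  (2 * b%:num)^-1 * expR (- `|x - delta| / b%:num).

Lemma laplace_pdf_ge0 delta b x : 0 <= laplace_pdf delta b x.
Proof. by rewrite mulr_ge0 ?expR_ge0. Qed.

Lemma continuous_laplace_pdf delta b : continuous (laplace_pdf delta b).
Proof.
move=> x; apply: cvgM; first exact: cvg_cst.
apply: continuous_comp; last exact: continuous_expR.
apply: cvgM; last exact: cvg_cst.
apply: cvgN; apply: cvg_norm.
by apply: cvgB; [exact: cvg_id|exact: cvg_cst].
Qed.

Lemma measurable_laplace_pdf delta b :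
  measurable_fun [set: R] (laplace_pdf delta b).
Proof. exact: continuous_measurable_fun (@continuous_laplace_pdf delta b). Qed.

Let integral_laplace_pdf_pos b :
  (\int[leb]_(x in [set x : R | (0 <= x)%R]) (laplace_pdf 0 b x)%:E = 2^-1%:E)%E.
Proof.
rewrite -set_itvcy.
pose c := b%:num^-1.
pose F (x : R) : R := - 2^-1 * expR (- c * x).
have dF x : is_derive (x : R) 1 F (2^-1 * c * expR (- c * x)).
  rewrite /F; apply: is_derive_eq.
  by rewrite /GRing.scale /=; ring.
have cF : continuous F.
  move=> x; apply: differentiable_continuous; apply/derivable1_diffP.
  exact: ex_derive.
rewrite (@ge0_continuous_FTC2y _ (laplace_pdf 0 b) F 0 0).
- by rewrite /F mulr0 expR0 mulr1 sub0e -EFinN opprK.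
- by move=> x _; exact: laplace_pdf_ge0.
- exact/continuous_subspaceT/continuous_laplace_pdf.
- rewrite /F -[X in _ --> X](mulr0 (- 2^-1 : R)); apply: cvgM; first exact: cvg_cst.
  rewrite (_ : (fun x => expR (- c * x)) =
               (fun z => expR (- z)) \o (fun z => c * z)); last first.
    by apply/funext => x /=; rewrite mulNr.
  apply: (@cvg_comp _ _ _ _ _ _ (pinfty_nbhs R)); last exact: cvgr_expR.
  by apply: gt0_cvgMry; [rewrite /c|exact: cvg_id].
- by move=> x _; exact: ex_derive.
- by apply: cvg_at_right_filter; exact: cF.
- move=> x; rewrite in_itv /= andbT => x0.
  rewrite derive1E derive_val /laplace_pdf subr0 gtr0_norm// invfM.
  by rewrite /c mulNr mulNr (mulrC x).
Qed.

Lemma integral_laplace_pdf delta b :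
  (\int[leb]_x (laplace_pdf delta b x)%:E = 1)%E.
Proof.
pose F (x : R) := x - delta.
have dF x : is_derive (x : R) 1 F 1.
  by rewrite /F; apply: is_derive_eq; rewrite oppr0 addr0.
have F'E : F^`()%classic = cst 1.
  by apply/funext => x; rewrite derive1E derive_val.
transitivity (\int[leb]_x (laplace_pdf 0 b x)%:E)%E.
  rewrite [RHS](@increasing_ge0_integration_by_substitutionT _ F).
  - apply: eq_integral => x _; rewrite F'E !fctE mulr1.
    by rewrite /laplace_pdf /F subr0.
  - by move=> x y xy; rewrite /F ltrD2r.
  - by rewrite F'E => ?; exact: cvg_cst.
  - by rewrite F'E; exact: is_cvg_cst.
  - by rewrite F'E; exact: is_cvg_cst.
  - by move=> x; exact: ex_derive.
  - exact: cvg_addrr_Ny.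
  - exact: cvg_addrr.
  - exact: continuous_laplace_pdf.
  - by move=> x; exact: laplace_pdf_ge0.
rewrite ge0_symfun_integralT.
- by rewrite integral_laplace_pdf_pos -EFinM divff.
- by move=> x; exact: laplace_pdf_ge0.
- exact: continuous_laplace_pdf.
- by move=> x /=; rewrite /laplace_pdf !subr0 normrN.
Qed.

End laplace_pdf.

Definition laplace_prob {R : realType} (delta : R) (b : {posnum R}) :
    set _ -> \bar R :=
  fun V => (\int[lebesgue_measure]_(x in V) (laplace_pdf delta b x)%:E)%E.

Section laplace_probability.
Context {R : realType} (delta : R) (b : {posnum R}).
Local Notation laplace := (laplace_prob delta b).

Let laplace0 : laplace set0 = 0%E.
Proof. by rewrite /laplace_prob integral_set0. Qed.

Let laplace_ge0 A : (0 <= laplace A)%E.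
Proof.
by apply: integral_ge0 => x _; rewrite lee_fin laplace_pdf_ge0.
Qed.

Let laplace_sigma_additive : semi_sigma_additive laplace.
Proof.
move=> /= F mF tF mUF; rewrite /laplace_prob; apply: cvg_toP.
  apply: ereal_nondecreasing_is_cvgn => m n mn.
  apply: lee_sum_nneg_natr => // k _ _; apply: integral_ge0 => /= x Fkx.
  by rewrite lee_fin laplace_pdf_ge0.
rewrite ge0_integral_bigcup//=.
- apply/measurable_funTS/measurableT_comp => //.
  exact: measurable_laplace_pdf.
- by move=> x _; rewrite lee_fin laplace_pdf_ge0.
Qed.

HB.instance Definition _ := isMeasure.Build _ _ _
  laplace laplace0 laplace_ge0 laplace_sigma_additive.

Let laplace_setT : laplace [set: _] = 1%E.
Proof. exact: integral_laplace_pdf. Qed.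

HB.instance Definition _ :=
  @Measure_isProbability.Build _ _ R laplace laplace_setT.

End laplace_probability.

Section product_probability.
Context d (T : measurableType d) (R : realType).

Definition tuple_cons n (x : T * n.-tuple T) : n.+1.-tuple T :=
  [tuple of x.1 :: x.2].

Lemma measurable_tuple_cons n :
  measurable_fun [set: T * n.-tuple T] (@tuple_cons n).
Proof. exact: measurable_cons. Qed.

HB.instance Definition _ n := isMeasurableFun.Build _ _ _ _ (@tuple_cons n)
  (@measurable_tuple_cons n).

(* Law of a vector with independent coordinates, the i-th one of law P i;
   the library only has binary products. *)
Fixpoint prod_prob n : ('I_n -> probability T R) -> probability (n.-tuple T) R :=
  match n with
  | 0 => fun _ => \d_([tuple] : 0.-tuple T)
  | m.+1 => fun P =>
      distribution (P ord0 \x prod_prob (fun i : 'I_m => P (lift ord0 i)))%E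
                   (@tuple_cons m)
  end.

(* Boxes form a pi-system generating the sigma-algebra of n.-tuple T, so this
   identity characterizes prod_prob P. *)
Lemma prod_prob_box n (P : 'I_n -> probability T R) (A : 'I_n -> set T) :
  (forall i, measurable (A i)) ->
  prod_prob P [set x | forall i, A i (tnth x i)] = (\prod_(i < n) P i (A i))%E.
Proof.
elim: n => [|n IH] in P A * => mA.
  by rewrite big_ord0 /= diracE mem_set// => -[].
rewrite big_ord_recl -IH//= -product_measure1E//; last first.
  rewrite (_ : [set _ | _] = \bigcap_(i in [set: 'I_n])
      ((fun x : n.-tuple T => tnth x i) @^-1` A (lift ord0 i))).
    apply: fin_bigcap_measurable => // i _; rewrite -[X in measurable X]setTI.
    exact: measurable_tnth.
  by apply/seteqP; split => x /= + i => /(_ i); [move=> + _; apply|apply].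
congr (_ \x _)%E; apply/seteqP; split => -[x y] /=.
  move=> h; split; first by have := h ord0; rewrite tnth0.
  by move=> i; have := h (lift ord0 i); rewrite tnthS.
move=> [Ax Ay] i; case: (unliftP ord0 i) => [j ->|->]; last by rewrite tnth0.
by rewrite tnthS; exact: Ay.
Qed.

End product_probability.

Definition laplace_vec {R : realType} p (delta : p.-tuple R) (b : {posnum R}) :
    probability (p.-tuple (measurableTypeR R)) R :=
  prod_prob (fun i => laplace_prob (tnth delta i) b).

Section tradeoff.
Context d (T : measurableType d) (R : realType).
Local Open Scope ereal_scope.

Definition is_test (phi : {mfun T >-> R}) := forall x, (0 <= phi x <= 1)%R.

(* Valued in \bar R, where infima need no side conditions; for alpha >= 0 the
   value is real since phi = 0 is admissible. *)
Definition tradeoff (P Q : probability T R) (alpha : R) : \bar R :=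
  ereal_inf [set 1 - 'E_Q[phi] | phi in
    [set phi : {mfun T >-> R} | is_test phi /\ 'E_P[phi] <= alpha%:E]].

End tradeoff.

Definition tradeoff_ge {R : realType} (f g : R -> \bar R) :=
  forall alpha, 0 <= alpha <= 1 -> (g alpha <= f alpha)%E.

Definition gauss_tradeoff {R : realType} (mu : R) : R -> \bar R :=
  tradeoff (normal_prob 0 1) (normal_prob mu 1).

Definition neighbors (X : Type) n (S S' : n.-tuple X) :=
  exists j, tnth S j <> tnth S' j /\
            forall k, k != j -> tnth S k = tnth S' k.

(* A mechanism is represented by the law of its output on each dataset. *)
Definition mechanism (X : Type) n d (Y : measurableType d) (R : realType) :=
  n.-tuple X -> probability Y R.

Definition is_gdp (X : Type) n d (Y : measurableType d) (R : realType)
    (mu : R) (M : mechanism X n Y R) :=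
  tradeoff_ge
    (fun alpha => ereal_inf [set tradeoff (M SS.1) (M SS.2) alpha | SS in
       [set SS : n.-tuple X * n.-tuple X | neighbors SS.1 SS.2]])
    (gauss_tradeoff mu).

Section laplace_mechanism.
Context {R : realType}.

(* R with the Borel structure carried by lebesgue_measure, hence by
   laplace_prob and normal_prob. *)
Local Notation mR := (measurableTypeR R).

Definition tuple_shift p (a : p.-tuple R) (x : p.-tuple mR) : p.-tuple mR :=
  [tuple tnth a i + (tnth x i : R) | i < p].

Lemma measurable_tuple_shift p (a : p.-tuple R) :
  measurable_fun [set: p.-tuple mR] (tuple_shift a).
Proof.
apply/measurable_fun_tnthP => i.
rewrite (_ : _ \o _ = fun x : p.-tuple mR => tnth a i + (tnth x i : R)); last first.
  by apply/funext => x /=; rewrite tnth_mktuple.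
by apply: measurable_funD => //; exact: measurable_tnth.
Qed.

HB.instance Definition _ p (a : p.-tuple R) :=
  isMeasurableFun.Build _ _ _ _ (tuple_shift a) (measurable_tuple_shift a).

Definition laplace_mechanism (X : Type) n p (theta : n.-tuple X -> p.-tuple R)
    (b : {posnum R}) : mechanism X n (p.-tuple mR) R :=
  fun S => distribution (laplace_vec [tuple 0 | _ < p] b) (tuple_shift (theta S)).

Definition freq_table (X : Type) n p (C : 'I_p -> set X) (S : n.-tuple X) :
    p.-tuple R :=
  [tuple (count (fun x => x \in C i) S)%:R | i < p].

Definition freq_tradeoff (b : {posnum R}) : R -> \bar R :=
  tradeoff (laplace_vec [tuple 0; 0] b) (laplace_vec [tuple 1; 1] b).

(* In \bar R, so that an empty infimum would be +oo and not a junk real. *)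
Definition b_tilde (mu : R) : \bar R :=
  ereal_inf [set b%:num%:E | b in
    [set b : {posnum R} | tradeoff_ge (freq_tradeoff b) (gauss_tradeoff mu)]].

End laplace_mechanism.

(* Main.v *)
(* Only the two changed cells of a frequency table matter, and reflecting the
   cell that loses a record turns the pair of locations (0, 0), (-1, 1) into
   (0, 0), (1, 1): for neighbors that change cell, T(M(S), M(S')) equals
   L_freq(b), and for the others it is 1 - alpha, which dominates G_mu.
   It remains to see that {b : L_freq(b) >= G_mu} is an up-set containing its
   infimum.
   - For b < b', Lap(a, b') is the law of X + N, where X has law Lap(a, b) and
     N is an independent noise whose law does not depend on a; hence L_freq is
     nondecreasing in b, by data processing.
   - The densities satisfy f_b' >= (b / b') f_b, so that a test at scale b
     yields, after multiplication by a factor tending to 1 as b' decreases to b,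
     a test of the same level at scale b' whose power tends to the original one. *)
Require Import Defs.
From HB Require Import structures.
From mathcomp Require Import all_boot all_order all_algebra.
From mathcomp Require Import all_classical all_reals all_analysis.
From mathcomp Require Import measurable_realfun ring lra.

Set Implicit Arguments.
Unset Strict Implicit.
Unset Printing Implicit Defensive.

Import Order.TTheory GRing.Theory Num.Theory.
Import numFieldNormedType.Exports.
Local Open Scope classical_set_scope.
Local Open Scope ring_scope.

(** * Integration against a measure with a density *)

Section density.
Local Open Scope ereal_scope.
Context d (T : measurableType d) (R : realType).
Variables (m nu : {measure set T -> \bar R}) (h : T -> R).
Hypotheses (mh : measurable_fun [set: T] h) (h0 : forall x, (0 <= h x)%R).
Hypothesis nuE : forall A, measurable A -> nu A = \int[m]_(x in A) (h x)%:E.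

Import HBNNSimple.

Let integral_density_nnsfun (f : {nnsfun T >-> R}) :
  \int[nu]_x (f x)%:E = \int[m]_x ((f x)%:E * (h x)%:E).
Proof.
under [RHS]eq_integral => x _.
  rewrite muleC fimfunE -fsumEFin// ge0_mule_fsumr; last first.
    by move=> r; rewrite EFinM nnfun_muleindic_ge0.
  over.
rewrite [RHS]ge0_integral_fsum//; last 2 first.
- move=> r; apply/emeasurable_funM; apply/measurable_EFinP => //.
  by apply: measurableT_comp.
- move=> r x _; apply: mule_ge0; first by rewrite lee_fin.
  by rewrite EFinM nnfun_muleindic_ge0.
rewrite integralT_nnsfun sintegralE; apply: eq_fsbigr => r /set_mem [t _ <-].
rewrite nuE// -ge0_integralZl//; last 3 first.
- by apply/measurable_funTS/measurable_EFinP.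
- by move=> x _; rewrite lee_fin.
- by rewrite lee_fin.
rewrite integral_mkcond; apply: eq_integral => x _.
by rewrite patchE indicE; case: ifPn => _; rewrite ?mulr1 ?mulr0 ?mule0// muleC.
Qed.

(** For simple functions this is [nuE] summed over the level sets; monotone convergence along
    [nnsfun_approx] on both sides carries it to [f]. *)
Lemma ge0_integral_density (f : T -> \bar R) : measurable_fun [set: T] f ->
  (forall x, 0 <= f x) -> \int[nu]_x f x = \int[m]_x (f x * (h x)%:E).
Proof.
move=> mf f0; pose f_ := nnsfun_approx measurableT mf.
have cvgf x : (f_ n x)%:E @[n --> \oo] --> f x.
  exact: cvg_nnsfun_approx.
have ndf x : {homo (fun n => (f_ n x)%:E) : a b / (a <= b)%N >-> a <= b}.
  by move=> a b ab; rewrite lee_fin; exact/lefP/nd_nnsfun_approx.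
transitivity (limn (fun n => \int[nu]_x (f_ n x)%:E)).
  rewrite -monotone_convergence//=.
  - by apply: eq_integral => x _; apply/esym/cvg_lim.
  - by move=> n; exact/measurable_EFinP.
  - by move=> n x _; rewrite lee_fin.
under eq_fun do rewrite integral_density_nnsfun.
rewrite -monotone_convergence//=.
- apply: eq_integral => x _; apply/cvg_lim => //.
  by apply: cvgeZr => //; exact: cvgf.
- by move=> n; apply/emeasurable_funM; exact/measurable_EFinP.
- by move=> n x _; rewrite mule_ge0// lee_fin.
- by move=> x _ a b ab; rewrite lee_pmul// ?lee_fin//; exact: ndf.
Qed.

End density.

(** * Translations and reflections of the line *)

Section laplace_reals.
Context {R : realType}.
Implicit Types (a t : R) (b : {posnum R}).
Local Notation leb := (@lebesgue_measure R).
Local Notation mR := (measurableTypeR R).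

(** One family for translations ([s = false]) and reflections ([s = true]), so that a cell that
    gains a record and a cell that loses one obey the same lemmas. *)
Definition signed_shift (s : bool) t (x : mR) : mR := t + (-1) ^+ s * (x : R).

Lemma measurable_signed_shift s t : measurable_fun [set: mR] (signed_shift s t).
Proof. by apply: measurable_funD => //; apply: measurable_funM. Qed.

HB.instance Definition _ s t := isMeasurableFun.Build _ _ _ _ (signed_shift s t)
  (measurable_signed_shift s t).

Lemma lebesgue_measure_signed_shift s t (A : set mR) : measurable A ->
  leb (signed_shift s t @^-1` A) = leb A.
Proof.
move=> mA; rewrite -[LHS]/(pushforward leb (signed_shift s t) A).
apply/esym/lebesgue_measure_unique => // _ [[x y] _ <-] /=; rewrite /pushforward.
(* By uniqueness of Lebesgue measure the intervals []x, y]] suffice. A reflection exchanges the open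
   and the closed end, hence the two forms of the preimage. *)
rewrite (_ : signed_shift s t @^-1` _ =
    (if s then `[t - y, t - x[ else `]x - t, y - t])%classic).
  case: s; rewrite !lebesgue_measure_itv /= !lte_fin -!EFinB.
    by rewrite ltrD2l ltrN2; congr (if _ then _%:E else _); ring.
  by rewrite ltrD2r; congr (if _ then _%:E else _); ring.
apply/seteqP; case: s; split => z; rewrite /signed_shift /= !in_itv /=;
  by move=> /andP[? ?]; apply/andP; split; lra.
Qed.

Lemma ge0_integral_signed_shift s t (D : set mR) (f : mR -> \bar R) :
  measurable D -> measurable_fun D f -> {in D, forall x, 0 <= f x}%E ->
  (\int[leb]_(x in D) f x =
   \int[leb]_(x in signed_shift s t @^-1` D) (f \o signed_shift s t) x)%E.
Proof.
move=> mD mf f0; rewrite -[RHS]ge0_integral_pushforward//.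
by apply/esym/eq_measure_integral => B mB _; exact: lebesgue_measure_signed_shift.
Qed.

(** The map preserves Lebesgue measure and distances, and the density depends only on the distance
    to the location. *)
Lemma laplace_prob_signed_shift a s t b (A : set mR) : measurable A ->
  laplace_prob a b (signed_shift s t @^-1` A) =
  laplace_prob (t + (-1) ^+ s * a) b A.
Proof.
move=> mA; rewrite /laplace_prob; set c := t + _.
rewrite [RHS](ge0_integral_signed_shift s t)//; last 2 first.
- by apply/measurable_funTS/measurable_EFinP; exact: measurable_laplace_pdf.
- by move=> y _; rewrite lee_fin laplace_pdf_ge0.
apply: eq_integral => x _ /=; congr EFin; rewrite /laplace_pdf /signed_shift /c.
by rewrite opprD addrACA subrr add0r -mulrBr normrM normrX normrN1 expr1n mul1r.
Qed.

End laplace_reals.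

(** * Convolution of two Laplace densities *)

Section convolution.
Context {R : realType}.
Implicit Types (a : R) (b : {posnum R}).
Local Notation leb := (@lebesgue_measure R).

(** The factor [k / k] stays unsimplified so that the identity also holds at [k = 0], where the
    quotient is 0 by convention. *)
Let primitive (C k x : R) : is_derive x 1 (fun x => - (C / k) * expR (- k * x))
  (k / k * C * expR (- k * x)).
Proof. by apply: is_derive_eq; rewrite /GRing.scale /=; ring. Qed.

Let continuous_scaled_expR (C k : R) : continuous (fun x : R => C * expR (- k * x)).
Proof.
move=> x; apply: cvgM; first exact: cvg_cst.
apply: continuous_comp; last exact: continuous_expR.
by apply: cvgM; [exact: cvg_cst|exact: cvg_id].
Qed.

Lemma integral_expR_itvcy (C k m : R) : 0 < k -> 0 <= C ->
  (\int[leb]_(x in `[m, +oo[) (C * expR (- k * x))%:E =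
   (C / k * expR (- k * m))%:E)%E.
Proof.
move=> k0 C0; pose F (x : R) := - (C / k) * expR (- k * x).
have dF x : derivable F x 1 by have [] := primitive C k x.
rewrite (@ge0_continuous_FTC2y _ _ F m 0).
- by rewrite sub0e -EFinN /F mulNr opprK.
- by move=> x _; rewrite mulr_ge0// expR_ge0.
- exact/continuous_subspaceT/continuous_scaled_expR.
- rewrite /F -[X in _ --> X](mulr0 (- (C / k))); apply: cvgM; first exact: cvg_cst.
  rewrite (_ : (fun x => expR (- k * x)) =
               (fun z => expR (- z)) \o (fun z => k * z)); last first.
    by apply/funext => x /=; rewrite mulNr.
  apply: (@cvg_comp _ _ _ _ _ _ (pinfty_nbhs R)); last exact: cvgr_expR.
  by apply: gt0_cvgMry; [|exact: cvg_id].
- by move=> x _; exact: dF.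
- by apply: cvg_at_right_filter; exact: continuous_scaled_expR.
- move=> x _; rewrite derive1E; have := primitive C k x => ?.
  by rewrite derive_val divff ?gt_eqF// mul1r.
Qed.

Lemma integral_expR_itvNyc (C k m : R) : 0 < k -> 0 <= C ->
  (\int[leb]_(x in `]-oo, m]) (C * expR (- - k * x))%:E =
   (C / k * expR (- - k * m))%:E)%E.
Proof.
move=> k0 C0; rewrite -[m in `]-oo, m]]opprK ge0_integration_by_substitutionNy.
- under eq_integral do rewrite /= mulrNN.
  by rewrite integral_expR_itvcy// mulrN !mulNr.
- exact/continuous_subspaceT/continuous_scaled_expR.
- by move=> x _; rewrite mulr_ge0// expR_ge0.
Qed.

Lemma integral_expR_itvcc (C k p q : R) : k != 0 -> p <= q ->
  (\int[leb]_(x in `[p, q]) (C * expR (- k * x))%:E =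
   (C / k * (expR (- k * p) - expR (- k * q)))%:E)%E.
Proof.
move=> k0; rewrite le_eqVlt => /predU1P[->|pq].
  by rewrite set_itv1 integral_set1 subrr mulr0.
pose F (x : R) := - (C / k) * expR (- k * x).
have dF x : derivable F x 1 by have [] := primitive C k x.
rewrite (@continuous_FTC2 _ _ F)//.
- by rewrite -EFinB /F; congr EFin; ring.
- exact/continuous_subspaceT/continuous_scaled_expR.
- split => //.
  + by apply: cvg_at_right_filter; exact: continuous_scaled_expR.
  + by apply: cvg_at_left_filter; exact: continuous_scaled_expR.
- move=> x _; rewrite derive1E; have := primitive C k x => ?.
  by rewrite derive_val divff// mul1r.
Qed.

(** Closed form of the integral over [x] of [expR (- u * |x - a| - v * |y - x|)]: the quotient by
    [u + v] comes from the two half-lines outside the segment between [a] and [y], the quotient by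
    [u - v] from the segment. *)
Let conv (u v a y : R) : R :=
  (expR (- u * `|y - a|) + expR (- v * `|y - a|)) / (u + v) +
  (expR (- v * `|y - a|) - expR (- u * `|y - a|)) / (u - v).

Let continuous_kernel (u v a y : R) :
  continuous (fun x : R => expR (- u * `|x - a| - v * `|y - x|)).
Proof.
move=> x; apply: continuous_comp; last exact: continuous_expR.
apply: cvgB; (apply: cvgM; first exact: cvg_cst); apply: cvg_norm.
  by apply: cvgB; [exact: cvg_id|exact: cvg_cst].
by apply: cvgB; [exact: cvg_cst|exact: cvg_id].
Qed.

Let measurable_kernel (u v a y : R) (D : set R) :
  measurable_fun D (fun x : R => (expR (- u * `|x - a| - v * `|y - x|))%:E).
Proof.
apply/measurable_funTS/measurable_EFinP.
exact: continuous_measurable_fun (@continuous_kernel u v a y).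
Qed.

Let integral_kernel_le (u v a y : R) : 0 < v -> v < u -> a <= y ->
  (\int[leb]_x (expR (- u * `|x - a| - v * `|y - x|))%:E = (conv u v a y)%:E)%E.
Proof.
move=> v0 vu ay; have u0 := lt_trans v0 vu.
(* On each of the three pieces cut out by [a] and [y], both absolute values have a fixed sign and
   the kernel is a constant times one exponential. *)
have -> : [set: R] = (`]-oo, a] `|` (`]a, y] `|` `]y, +oo[))%classic.
  apply/seteqP; split => x //= _; rewrite !in_itv /= andbT.
  by case: (leP x a) => ?; [left|right; case: (leP x y) => ?; [left|right]].
rewrite ge0_integral_setU//=; first last.
- rewrite disj_set2E; apply/eqP; rewrite -subset0 => x /=.
  by rewrite !in_itv /= andbT; lra.
- exact: measurable_kernel.
- by apply: measurableU.
rewrite ge0_integral_setU//=; first last.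
- rewrite disj_set2E; apply/eqP; rewrite -subset0 => x /=.
  by rewrite !in_itv /= andbT; lra.
- exact: measurable_kernel.
rewrite !integral_itv_obnd_cbnd//.
have -> : (\int[leb]_(x in `]-oo, a]) (expR (- u * `|x - a| - v * `|y - x|))%:E =
    \int[leb]_(x in `]-oo, a]) (expR (- u * a - v * y) * expR (- - (u + v) * x))%:E)%E.
  apply: eq_integral => x; rewrite inE /= in_itv /= => xa.
  rewrite -expRD ler0_norm ?subr_le0// ger0_norm ?subr_ge0 ?(le_trans xa)//.
  by congr (expR _)%:E; ring.
have -> : (\int[leb]_(x in `[a, y]) (expR (- u * `|x - a| - v * `|y - x|))%:E =
    \int[leb]_(x in `[a, y]) (expR (u * a - v * y) * expR (- (u - v) * x))%:E)%E.
  apply: eq_integral => x; rewrite inE /= in_itv /= => /andP[ax xy].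
  rewrite -expRD !ger0_norm ?subr_ge0//.
  by congr (expR _)%:E; ring.
have -> : (\int[leb]_(x in `[y, +oo[) (expR (- u * `|x - a| - v * `|y - x|))%:E =
    \int[leb]_(x in `[y, +oo[) (expR (u * a + v * y) * expR (- (u + v) * x))%:E)%E.
  apply: eq_integral => x; rewrite inE /= in_itv /= andbT => yx.
  rewrite -expRD ger0_norm ?subr_ge0 ?(le_trans ay)// ler0_norm ?subr_le0//.
  by congr (expR _)%:E; ring.
rewrite integral_expR_itvNyc ?expR_ge0 ?addr_gt0//.
rewrite integral_expR_itvcc ?subr_eq0 ?gt_eqF//.
rewrite integral_expR_itvcy ?expR_ge0 ?addr_gt0// -!EFinD; congr EFin.
set A := expR _; set B := expR _; set C := expR (u * a - v * y).
set D := expR _; set E := expR _; set F := expR _; set G := expR _.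
transitivity ((A * B + F * G) / (u + v) + (C * D - C * E) / (u - v)).
  by ring.
rewrite -!expRD /conv ger0_norm ?subr_ge0//.
rewrite (_ : - u * a - v * y + - - (u + v) * a = - v * (y - a)); last by ring.
rewrite (_ : u * a - v * y + - (u - v) * a = - v * (y - a)); last by ring.
rewrite (_ : u * a - v * y + - (u - v) * y = - u * (y - a)); last by ring.
rewrite (_ : u * a + v * y + - (u + v) * y = - u * (y - a)); last by ring.
by congr (_ / _ + _); rewrite addrC.
Qed.

Let integral_kernel (u v a y : R) : 0 < v -> v < u ->
  (\int[leb]_x (expR (- u * `|x - a| - v * `|y - x|))%:E = (conv u v a y)%:E)%E.
Proof.
move=> v0 vu; have [ay|/ltW ya] := leP a y; first exact: integral_kernel_le.
(* The reflection [x -> - x] exchanges the two orders of [a] and [y]. *)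
transitivity (\int[leb]_x (expR (- u * `|x - (- a)| - v * `|- y - x|))%:E)%E.
  rewrite [LHS](ge0_integral_signed_shift true 0)//.
  - apply: eq_integral => x _ /=; rewrite /signed_shift add0r mulN1r.
    by rewrite !opprK -!opprD !normrN.
  - exact: measurable_kernel.
rewrite integral_kernel_le ?lerN2//; congr EFin.
by rewrite /conv -opprD normrN.
Qed.

(** On characteristic functions this is the partial fraction decomposition of
    [1 / ((1 + b^2 t^2) (1 + b'^2 t^2))]. The proof evaluates [conv] at the rates [u = 1 / b] and
    [v = 1 / b']. *)
Lemma laplace_pdf_convolution a b b' (y : R) : b%:num < b'%:num ->
  (\int[leb]_x (laplace_pdf x b' y * laplace_pdf a b x)%:E =
   ((b'%:num ^+ 2 - b%:num ^+ 2)^-1 *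
    (b'%:num ^+ 2 * laplace_pdf a b' y - b%:num ^+ 2 * laplace_pdf a b y))%:E)%E.
Proof.
move=> bb'; pose u := b%:num^-1; pose v := b'%:num^-1.
have v0 : 0 < v by rewrite invr_gt0.
have vu : v < u by rewrite ltf_pV2 ?posrE.
transitivity (\int[leb]_x (((2 * b'%:num)^-1 * (2 * b%:num)^-1)%:E *
    (expR (- u * `|x - a| - v * `|y - x|))%:E))%E.
  apply: eq_integral => x _; rewrite -EFinM; congr EFin; rewrite /laplace_pdf.
  rewrite mulrACA -expRD; congr (_ * expR _).
  by rewrite /u /v; ring.
rewrite ge0_integralZl//; last exact: measurable_kernel.
rewrite integral_kernel// -EFinM; congr EFin.
rewrite /conv /laplace_pdf.
rewrite (_ : - u * _ = - `|y - a| / b%:num); last by rewrite /u; ring.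
rewrite (_ : - v * _ = - `|y - a| / b'%:num); last by rewrite /v; ring.
set p := expR _; set q := expR _; move: bb'; rewrite /u /v.
have b0 : 0 < b%:num by []. have b'0 : 0 < b'%:num by [].
move: (b%:num) (b'%:num) b0 b'0 => r r' r0 r'0 rr'.
have rBr'0 : 0 < r' - r by rewrite subr_gt0.
have rDr'0 : 0 < r' + r by rewrite addr_gt0.
by field; rewrite mulN1r subr_sqr mulf_neq0 !gt_eqF.
Qed.

End convolution.

(** * The noise that raises the scale of a Laplace law *)

Section mixture.
Local Open Scope ereal_scope.
Context d (T : measurableType d) (R : realType) (c : R) (c01 : (0 <= c <= 1)%R).
Variables P Q : probability T R.

Let c_ge0 : (0 <= c)%R. Proof. by have /andP[] := c01. Qed.
Let onem_ge0 : (0 <= 1 - c)%R.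
Proof. by have /andP[_] := c01; rewrite subr_ge0. Qed.

Definition mixture : set T -> \bar R :=
  measure_add (mscale (NngNum c_ge0) P) (mscale (NngNum onem_ge0) Q).

HB.instance Definition _ := Measure.on mixture.

Lemma mixtureE A : mixture A = c%:E * P A + (1 - c)%:E * Q A.
Proof. exact: measure_addE. Qed.

Let mixtureT : mixture setT = 1.
Proof.
by rewrite mixtureE !probability_setT !mule1 -EFinD addrC subrK.
Qed.

HB.instance Definition _ := Measure_isProbability.Build _ _ _ mixture mixtureT.

End mixture.

Section noise.
Local Open Scope ereal_scope.
Context {R : realType}.
Implicit Types (a : R) (b : {posnum R}).
Local Notation leb := (@lebesgue_measure R).
Local Notation mR := (measurableTypeR R).

Lemma ge0_integral_laplace_prob a b (f : mR -> \bar R) :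
  measurable_fun [set: mR] f -> (forall x, 0 <= f x) ->
  \int[laplace_prob a b]_x f x = \int[leb]_x (f x * (laplace_pdf a b x)%:E).
Proof.
move=> mf f0; rewrite (@ge0_integral_density _ _ _ leb (laplace_prob a b)
  (laplace_pdf a b))//.
- exact: measurable_laplace_pdf.
- exact: laplace_pdf_ge0.
Qed.

Let measurable_laplace_pdf2 b :
  measurable_fun [set: mR * mR] (fun z : mR * mR => laplace_pdf z.1 b z.2).
Proof.
rewrite (_ : (fun _ => _) = laplace_pdf 0 b \o
    (fun z : mR * mR => ((z.2 : R) - (z.1 : R))%R : mR)); last first.
  by apply/funext => z /=; rewrite /laplace_pdf subr0.
apply: measurableT_comp; first exact: measurable_laplace_pdf.
by apply: measurable_funB; [exact: measurable_snd|exact: measurable_fst].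
Qed.

Let kernel b (A : set mR) (z : mR * mR) := (laplace_pdf z.1 b z.2 * \1_A z.2)%:E.

Let kernel_ge0 b (A : set mR) z : 0 <= kernel b A z.
Proof. by rewrite lee_fin mulr_ge0 ?laplace_pdf_ge0// indicE. Qed.

Let measurable_kernel b (A : set mR) : measurable A ->
  measurable_fun [set: mR * mR] (kernel b A).
Proof.
move=> mA; apply/measurable_EFinP; apply: measurable_funM.
  exact: measurable_laplace_pdf2.
by apply: measurableT_comp; [exact: measurable_indic|exact: measurable_snd].
Qed.

Let laplace_probE x b (A : set mR) :
  laplace_prob x b A = \int[leb]_y kernel b A (x, y).
Proof.
rewrite /laplace_prob [LHS]integral_mkcond.
apply: eq_integral => y _; rewrite patchE /kernel /= indicE.
by case: ifPn => _; rewrite ?mulr1 ?mulr0.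
Qed.

Lemma measurable_laplace_prob b (A : set mR) : measurable A ->
  measurable_fun [set: mR] (fun x : mR => laplace_prob x b A).
Proof.
move=> mA; rewrite (_ : (fun _ => _) = fubini_F leb (kernel b A)).
  by apply: measurable_fun_fubini_tonelli_F => //; exact: measurable_kernel.
by apply/funext => x; exact: laplace_probE.
Qed.

(** Tonelli exchanges the location and the argument, so that the inner integral becomes a
    convolution of Laplace densities. *)
Lemma integral_laplace_prob_location a b b' (A : set mR) : measurable A ->
  \int[laplace_prob a b]_x laplace_prob x b' A =
  \int[leb]_(y in A) \int[leb]_x (laplace_pdf x b' y * laplace_pdf a b x)%:E.
Proof.
move=> mA; have mk := measurable_kernel b' mA.
pose g (z : mR * mR) := kernel b' A z * (laplace_pdf a b z.1)%:E.
have mg : measurable_fun [set: mR * mR] g.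
  apply: emeasurable_funM => //; apply/measurable_EFinP.
  by apply: measurableT_comp; [exact: measurable_laplace_pdf|exact: measurable_fst].
have g0 z : 0 <= g z by rewrite mule_ge0// lee_fin laplace_pdf_ge0.
transitivity (\int[leb]_x \int[leb]_y g (x, y)).
  rewrite ge0_integral_laplace_prob//; last exact: measurable_laplace_prob.
  apply: eq_integral => x _; rewrite [X in X * _]laplace_probE -ge0_integralZr//.
  - exact: measurableT_comp.
  - by rewrite lee_fin laplace_pdf_ge0.
rewrite (fubini_tonelli g mg g0) [RHS]integral_mkcond; apply: eq_integral => y _.
rewrite patchE /g /kernel /= indicE; case: ifPn => _; last first.
  by under eq_integral do rewrite mulr0 mul0e; rewrite integral0.
by under eq_integral do rewrite mulr1 -EFinM.
Qed.

(* The noise is 0 with probability c = (b / b')^2 and has law Lap(0, b')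
   otherwise: on characteristic functions,
   (c + (1 - c) / (1 + b'^2 t^2)) / (1 + b^2 t^2) = 1 / (1 + b'^2 t^2). *)
Lemma laplace_prob_add_noise b b' : (b%:num < b'%:num)%R ->
  exists nu : probability mR R, forall a (A : set mR), measurable A ->
    (laplace_prob a b \x nu) [set z | A ((z.1 : R) + (z.2 : R))%R] =
    laplace_prob a b' A.
Proof.
move=> bb'; pose c := ((b%:num / b'%:num) ^+ 2)%R.
have c01 : (0 <= c <= 1)%R.
  by rewrite exprn_ge0//= expr_le1// ler_pdivrMr// mul1r ltW.
exists (mixture c01 (\d_(0%R : mR)) (laplace_prob 0 b')) => a A mA.
rewrite /product_measure1.
(* For fixed [x] the section of the event is [A] translated by [- x]: the atom of the noise
   contributes the indicator of [A] at [x], and its Laplace part contributes [Lap(x, b')]. *)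
transitivity (\int[laplace_prob a b]_x
    (c%:E * (\1_A x)%:E + (1 - c)%:E * laplace_prob x b' A)).
  apply: eq_integral => x _.
  rewrite [LHS]/= (_ : xsection _ _ = signed_shift false x @^-1` A); last first.
    by apply/seteqP; split => y; rewrite /xsection /= ?inE// /signed_shift mul1r.
  rewrite mixtureE /= (laplace_prob_signed_shift _ _ _ _ mA) mulr0 addr0.
  rewrite diracE indicE; congr (_ * _%:R%:E + _).
  transitivity (signed_shift false x 0%R \in A) => //.
  by congr (_ \in A); rewrite /signed_shift mulr0 addr0.
have /andP[c0 c1] := c01.
have onem_c0 : (0 <= 1 - c)%R by rewrite subr_ge0.
have mL := measurable_laplace_prob b' mA.
have mf r : measurable_fun A (fun x => (laplace_pdf a r x)%:E).
  by apply/measurable_funTS/measurable_EFinP; exact: measurable_laplace_pdf.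
rewrite ge0_integralD//; last 4 first.
- by move=> x _; rewrite mule_ge0 ?lee_fin// indicE.
- by apply: emeasurable_funM => //; apply/measurable_EFinP.
- by move=> x _; rewrite mule_ge0 ?lee_fin.
- exact: emeasurable_funM.
rewrite !ge0_integralZl//; last exact/measurable_EFinP.
rewrite integral_indic// setIT integral_laplace_prob_location//.
under eq_integral do rewrite laplace_pdf_convolution//.
set D := fun y : mR => ((b'%:num ^+ 2 - b%:num ^+ 2)^-1 *
  (b'%:num ^+ 2 * laplace_pdf a b' y - b%:num ^+ 2 * laplace_pdf a b y))%R.
rewrite -[X in _ + _ * X = _]/(\int[leb]_(y in A) (D y)%:E).
have mD : measurable_fun A (fun y => (D y)%:E).
  apply/measurable_EFinP; apply: measurable_funM => //.
  by apply: measurable_funB; apply: measurable_funM => //;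
    apply: measurable_funTS; exact: measurable_laplace_pdf.
(* The sign is not visible on this difference, but [D y] is the integral of a product of
   densities. *)
have D0 y : 0 <= (D y)%:E.
  rewrite /D -laplace_pdf_convolution//; apply: integral_ge0 => x _.
  by rewrite lee_fin mulr_ge0// laplace_pdf_ge0.
have f0 r y : 0 <= (laplace_pdf a r y)%:E by rewrite lee_fin laplace_pdf_ge0.
rewrite /laplace_prob -!ge0_integralZl// -ge0_integralD//; last 4 first.
- by move=> x _; apply: mule_ge0.
- exact: emeasurable_funM.
- by move=> x _; apply: mule_ge0.
- exact: emeasurable_funM.
(* Since [(1 - c) / (b'^2 - b^2) = 1 / b'^2], the density at scale [b] cancels and the one at scale
   [b'] remains. *)
apply: eq_integral => y _; rewrite -!EFinM -EFinD /D /c; congr EFin.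
have b0 : (0 < b%:num)%R by [].
have b'0 : (0 < b'%:num)%R by [].
have bBb'0 : (0 < b'%:num - b%:num)%R by rewrite subr_gt0.
have bDb'0 : (0 < b'%:num + b%:num)%R by rewrite addr_gt0.
by field; rewrite subr_sqr mulf_neq0 !gt_eqF.
Qed.

End noise.

(** * Trade-off functions and data processing *)

Lemma eq_tradeoff d (T : measurableType d) (R : realType)
    (P Q P' Q' : probability T R) (alpha : R) :
  (forall A, measurable A -> P A = P' A) ->
  (forall A, measurable A -> Q A = Q' A) ->
  tradeoff P Q alpha = tradeoff P' Q' alpha.
Proof.
have eqE (M M' : probability T R) (phi : {mfun T >-> R}) :
    (forall A, measurable A -> M A = M' A) -> ('E_M[phi] = 'E_M'[phi])%E.
  move=> MM'; rewrite !expectation_def.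
  by apply: eq_measure_integral => A mA _; exact: MM'.
move=> PP' QQ'; congr ereal_inf; apply/seteqP.
by split => _ [phi [t phia] <-]; exists phi;
  rewrite ?(eqE _ _ _ QQ')//=; split=> //; rewrite -?(eqE _ _ _ PP')//
    (eqE _ _ _ PP').
Qed.

Section tradeoff_facts.
Local Open Scope ereal_scope.
Context {R : realType}.

Section basic.
Context d (T : measurableType d).
Implicit Types (P Q : probability T R) (phi : {mfun T >-> R}).

Lemma tradeoff_le P Q alpha phi : is_test phi -> 'E_P[phi] <= alpha%:E ->
  tradeoff P Q alpha <= 1 - 'E_Q[phi].
Proof. by move=> t a; apply: ereal_inf_lbound; exists phi. Qed.

(** The constant test [alpha] has level and power [alpha]. *)
Lemma tradeoff_onem P Q (alpha : R) : (0 <= alpha <= 1)%R ->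
  tradeoff P Q alpha <= 1 - alpha%:E.
Proof.
move=> a01; have := @tradeoff_le P Q alpha (cst alpha).
by rewrite !expectation_cst; apply.
Qed.

Lemma expectation_test P phi : is_test phi ->
  exists2 x : R, (0 <= x <= 1)%R & 'E_P[phi] = x%:E.
Proof.
move=> t; have e0 : 0 <= 'E_P[phi].
  by apply: expectation_ge0 => x; have /andP[] := t x.
have e1 : 'E_P[phi] <= 1.
  rewrite expectation_def -(@probability_setT _ _ _ P) -[leRHS]mul1e -integral_cst//.
  apply: ge0_le_integral => //.
  - by move=> x _; rewrite lee_fin; have /andP[] := t x.
  - exact/measurable_EFinP.
  - by move=> x _; rewrite lee_fin; have /andP[] := t x.
have eE : (fine 'E_P[phi])%:E = 'E_P[phi].
  by rewrite fineK// ge0_fin_numE// (le_lt_trans e1)// ltry.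
by exists (fine 'E_P[phi]); rewrite // -!lee_fin eE e0 e1.
Qed.

Lemma ge0_le_expectation (c : {nonneg R}) P Q phi : is_test phi ->
  (forall A, measurable A -> c%:num%:E * P A <= Q A) ->
  c%:num%:E * 'E_P[phi] <= 'E_Q[phi].
Proof.
move=> t PQ; rewrite !expectation_def -ge0_integral_mscale//; last 2 first.
- exact/measurable_EFinP.
- by move=> x _; rewrite lee_fin; have /andP[] := t x.
apply: ge0_le_measure_integral => //.
- by move=> x; rewrite lee_fin; have /andP[] := t x.
- exact/measurable_EFinP.
Qed.

End basic.

(** Data processing with independent randomness of law [N]: averaging [phi' (g (x, z))] over [z]
    turns a test of the output into a test of [x] with the same expectations under both
    hypotheses. *)
Lemma tradeoff_garble d1 d2 d3 (X : measurableType d1) (Z : measurableType d2)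
    (Y : measurableType d3) (P Q : probability X R) (N : probability Z R)
    (g : {mfun (X * Z)%type >-> Y}) (P' Q' : probability Y R) (alpha : R) :
  (forall A, measurable A -> P' A = (P \x N) (g @^-1` A)) ->
  (forall A, measurable A -> Q' A = (Q \x N) (g @^-1` A)) ->
  tradeoff P Q alpha <= tradeoff P' Q' alpha.
Proof.
move=> PE QE; apply: le_ereal_inf_tmp => _ [phi' [t' a'] <-].
have mpg : measurable_fun [set: (X * Z)%type] (fun z => (phi' (g z))%:E).
  by apply/measurable_EFinP; exact: measurableT_comp.
have pg0 z : 0 <= (phi' (g z))%:E by rewrite lee_fin; have /andP[] := t' (g z).
pose k x := \int[N]_z (phi' (g (x, z)))%:E.
have k0 x : 0 <= k x by exact: integral_ge0.
have k1 x : k x <= 1.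
  rewrite -(@probability_setT _ _ _ N) -[leRHS]mul1e -integral_cst//.
  apply: ge0_le_integral => //.
  - exact: measurableT_comp mpg (pair1_measurable x).
  - by move=> z _; rewrite lee_fin; have /andP[] := t' (g (x, z)).
have kE x : (fine (k x))%:E = k x.
  by rewrite fineK// ge0_fin_numE// (le_lt_trans (k1 x))// ltry.
have mk : measurable_fun [set: X] k.
  exact: (measurable_fun_fubini_tonelli_F (fun z => (phi' (g z))%:E)).
have mphi : measurable_fun [set: X] (fine \o k) by exact: measurableT_comp.
pose phi : {mfun X >-> R} := HB.pack (fine \o k)
  (isMeasurableFun.Build _ _ _ _ _ mphi).
have E (M : probability X R) (M' : probability Y R) :
    (forall A, measurable A -> M' A = (M \x N) (g @^-1` A)) ->
    'E_M'[phi'] = 'E_M[phi].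
  move=> ME; rewrite !expectation_def.
  transitivity (\int[distribution (M \x N) g]_y (phi' y)%:E).
    by apply: eq_measure_integral => A mA _; exact: ME.
  rewrite ge0_integral_distribution//; last 2 first.
  - exact/measurable_EFinP.
  - by move=> y; rewrite lee_fin; have /andP[] := t' y.
  rewrite fubini_tonelli1//; apply: eq_integral => x _.
  by rewrite /= kE.
rewrite (E _ _ QE); apply: tradeoff_le; last by rewrite -(E _ _ PE).
by move=> x; rewrite /= -!lee_fin kE k0 k1.
Qed.

End tradeoff_facts.

Section tradeoff_map.
Local Open Scope ereal_scope.
Context {R : realType}.

(** A deterministic map is a garbling whose randomness is the point mass on [unit]. *)
Lemma tradeoff_map d1 d2 (X : measurableType d1) (Y : measurableType d2)
    (P Q : probability X R) (g : {mfun X >-> Y}) (P' Q' : probability Y R)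
    (alpha : R) :
  (forall A, measurable A -> P' A = P (g @^-1` A)) ->
  (forall A, measurable A -> Q' A = Q (g @^-1` A)) ->
  tradeoff P Q alpha <= tradeoff P' Q' alpha.
Proof.
move=> PE QE.
have mg1 : measurable_fun [set: (X * unit)%type] (g \o fst).
  by apply: measurableT_comp => //; exact: measurable_fst.
pose g1 : {mfun (X * unit)%type >-> Y} := HB.pack (g \o fst)
  (isMeasurableFun.Build _ _ _ _ _ mg1).
have E (M : probability X R) (M' : probability Y R) :
    (forall A, measurable A -> M' A = M (g @^-1` A)) ->
    forall A, measurable A -> M' A = (M \x (\d_tt : probability _ R)) (g1 @^-1` A).
  move=> ME A mA; have mgA : measurable (g @^-1` A).
    by rewrite -[X in measurable X]setTI; exact: measurable_funP.
  rewrite (_ : g1 @^-1` A = (g @^-1` A) `*` setT); last first.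
    by apply/seteqP; split=> [z|z []].
  by rewrite product_measure1E// [X in _ * X]diracE in_setT mule1 ME.
by apply: (@tradeoff_garble R _ _ _ X unit Y P Q (\d_tt) g1); exact: E.
Qed.

End tradeoff_map.

(** * Product laws on tuples *)

Section product_law.
Local Open Scope ereal_scope.
Context d (T : measurableType d) (R : realType).

Lemma emeasurable_prod d' (X : measurableType d') n (h : 'I_n -> X -> \bar R) :
  (forall i, measurable_fun [set: X] (h i)) ->
  measurable_fun [set: X] (fun x => \prod_(i < n) h i x).
Proof.
elim: n => [|n IH] in h *; move=> mh.
  by under eq_fun do rewrite big_ord0; exact: measurable_cst.
under eq_fun do rewrite big_ord_recl.
by apply: emeasurable_funM => //; exact: IH.
Qed.

Definition box n (A : 'I_n -> set T) : set (n.-tuple T) :=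
  [set x | forall i, A i (tnth x i)].

Lemma measurable_box n (A : 'I_n -> set T) : (forall i, measurable (A i)) ->
  measurable (box A).
Proof.
move=> mA; rewrite (_ : box A = \bigcap_(i in [set: 'I_n])
    ((fun x : n.-tuple T => tnth x i) @^-1` A i)).
  apply: fin_bigcap_measurable => // i _; rewrite -[X in measurable X]setTI.
  exact: measurable_tnth.
by apply/seteqP; split => x /= + i => /(_ i); [move=> + _; apply|apply].
Qed.

(** Boxes are stable under intersection and generate the sigma-algebra, a coordinate cylinder being
    a box whose other sides are full. Laws of images can thus be identified on boxes alone. *)
Lemma prod_prob_unique n (P : 'I_n -> probability T R)
    (m : probability (n.-tuple T) R) :
  (forall A, (forall i, measurable (A i)) -> m (box A) = \prod_(i < n) P i (A i)) ->
  forall B, measurable B -> m B = prod_prob P B.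
Proof.
move=> mE; pose G := [set box A | A in [set A | forall i : 'I_n, measurable (A i)]].
apply: (measure_unique G (fun=> setT)).
- rewrite eqEsubset; split.
    apply: smallest_sub; first exact: smallest_sigma_algebra.
    rewrite -bigcup_seq => B [i _ [A mA <-]]; apply: sub_sigma_algebra.
    exists (fun j => if j == i then A else setT) => /=.
      by move=> j; case: ifPn.
    apply/seteqP; split=> x /=.
      by move=> /(_ i); rewrite eqxx.
    by move=> [_ Ax] j; case: eqP => [->|].
  apply: smallest_sub; first exact: sigma_algebra_measurable.
  by move=> _ [A mA <-]; exact: measurable_box.
- move=> _ _ [A mA <-] [B mB <-]; exists (fun i => A i `&` B i).
    by move=> i; exact: measurableI.
  apply/seteqP; split=> x /=; first by move=> h; split => i; have [] := h i.
  by move=> [h k] i; split; [exact: h|exact: k].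
- by move=> _; exists (fun=> setT) => //; apply/seteqP; split.
- by apply/seteqP; split => // x _; exists 0%N.
- by move=> _ [A mA <-]; rewrite [LHS]mE// [RHS]prod_prob_box.
- by move=> _; rewrite (le_lt_trans (probability_le1 m _)) ?ltry.
Qed.

(** Induction on [n]: Tonelli peels off the first coordinate. *)
Lemma integral_prod_prob n (P : 'I_n -> probability T R) (h : 'I_n -> T -> \bar R) :
  (forall i, measurable_fun [set: T] (h i)) -> (forall i x, 0 <= h i x) ->
  \int[prod_prob P]_x \prod_(i < n) h i (tnth x i) =
  \prod_(i < n) \int[P i]_x h i x.
Proof.
elim: n => [|n IH] in P h *; move=> mh h0.
  rewrite big_ord0 /=; under eq_integral do rewrite big_ord0.
  by rewrite integral_cst// mul1e; exact: diracT.
have p0 m (k : 'I_m -> T -> \bar R) (x : m.-tuple T) :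
    (forall i x, 0 <= k i x) -> 0 <= \prod_(i < m) k i (tnth x i).
  by move=> k0; apply: prode_ge0.
have mp m (k : 'I_m -> T -> \bar R) : (forall i, measurable_fun [set: T] (k i)) ->
    measurable_fun [set: m.-tuple T] (fun x => \prod_(i < m) k i (tnth x i)).
  move=> mk; apply: emeasurable_prod => i; apply: measurableT_comp => //.
  exact: measurable_tnth.
rewrite ge0_integral_distribution//; [|exact: mp|by move=> x; exact: p0].
rewrite fubini_tonelli1//; last 2 first.
- exact: measurableT_comp (mp _ _ mh) (@measurable_tuple_cons _ T n).
- by move=> x; exact: p0.
rewrite big_ord_recl -IH// -ge0_integralZr//; last first.
  by apply: integral_ge0 => x _; apply: (p0 n (fun i => h (lift ord0 i))).
apply: eq_integral => x _.
rewrite /fubini_F -ge0_integralZl//; last 2 first.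
- exact: (mp n (fun i => h (lift ord0 i))).
- by move=> y _; apply: (p0 n (fun i => h (lift ord0 i))).
apply: eq_integral => y _ /=; rewrite big_ord_recl tnth0; congr (_ * _).
by apply: eq_bigr => i _; rewrite tnthS.
Qed.

(** One factor [c] is paid per coordinate: the induction hypothesis bounds the law of the tail on
    each section, then the law of the first coordinate is replaced. *)
Lemma prod_prob_le n (c : {nonneg R}) (P Q : 'I_n -> probability T R) :
  (forall i A, measurable A -> c%:num%:E * P i A <= Q i A) ->
  forall A, measurable A -> (c%:num ^+ n)%:E * prod_prob P A <= prod_prob Q A.
Proof.
elim: n => [|n IH] in P Q *; move=> PQ A mA; first by rewrite expr0 mul1e.
have mE : measurable (@tuple_cons _ T n @^-1` A).
  by rewrite -[X in measurable X]setTI; apply: measurable_tuple_cons.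
have {}IH := IH (fun i => P (lift ord0 i)) (fun i => Q (lift ord0 i))
  (fun i => PQ _).
rewrite /= /distribution /pushforward /product_measure1 exprS EFinM -muleA.
have c0 : 0 <= (c%:num ^+ n)%:E by rewrite lee_fin exprn_ge0.
rewrite -ge0_integralZl//; last exact: measurable_fun_xsection.
rewrite -ge0_integral_mscale//; last 2 first.
- by apply: emeasurable_funM => //; exact: measurable_fun_xsection.
- by move=> x _; apply: mule_ge0.
apply: (@le_trans _ _ (\int[mscale c (P ord0)]_x
    prod_prob (fun i => Q (lift ord0 i)) (xsection (@tuple_cons _ T n @^-1` A) x))).
  apply: ge0_le_integral => //.
  - by move=> x _; apply: mule_ge0.
  - by apply: emeasurable_funM => //; exact: measurable_fun_xsection.
  - exact: measurable_fun_xsection.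
  - by move=> x _; apply: IH; exact: measurable_xsection.
apply: ge0_le_measure_integral => //; first by move=> B mB; exact: PQ.
exact: measurable_fun_xsection.
Qed.

End product_law.

(** * Laplace vectors whose locations differ in two coordinates *)

Lemma forall_ord2 (P : 'I_2 -> Prop) : (forall k, P k) <-> P ord0 /\ P ord_max.
Proof.
split=> [h|[P0 P1] [[|[|//]] k2]]; first by split; exact: h.
  by rewrite (_ : Ordinal k2 = ord0)//; exact: val_inj.
by rewrite (_ : Ordinal k2 = ord_max)//; exact: val_inj.
Qed.

Lemma prode_D2 (R : realType) n (i j : 'I_n) (F : 'I_n -> \bar R) : i != j ->
  (\prod_(k < n) F k = F i * F j * \prod_(k < n | (k != i) && (k != j)) F k)%E.
Proof. by move=> ij; rewrite (bigD1 i)// (bigD1 j) 1?eq_sym//= muleA. Qed.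

Section laplace_vectors.
Local Open Scope ereal_scope.
Context {R : realType}.
Local Notation mR := (measurableTypeR R).

Let measurable_signed_shift_preimage s (t : R) (A : set mR) : measurable A ->
  measurable (signed_shift s t @^-1` A).
Proof.
by move=> mA; rewrite -[X in measurable X]setTI; exact: measurable_signed_shift.
Qed.

(** On a box, adding [theta S] translates each side, and each centered coordinate is relocated
    separately. *)
Lemma laplace_mechanismE (X : Type) n p (theta : n.-tuple X -> p.-tuple R) b S
    (A : set (p.-tuple mR)) : measurable A ->
  laplace_mechanism theta b S A = laplace_vec (theta S) b A.
Proof.
move: A; apply: prod_prob_unique => A mA.
transitivity (laplace_vec [tuple 0%R | _ < p] b
    (box (fun i => signed_shift false (tnth (theta S) i) @^-1` A i))).
  rewrite -[LHS]/(laplace_vec [tuple 0%R | _ < p] b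
    (tuple_shift (theta S) @^-1` box A)).
  congr (laplace_vec _ b _); apply/seteqP.
  by split => x /= Ax i; have := Ax i;
    rewrite /signed_shift tnth_mktuple expr0 /= mul1r.
rewrite [LHS]prod_prob_box => [|i]; last exact: measurable_signed_shift_preimage.
apply: eq_bigr => i _.
rewrite [LHS](laplace_prob_signed_shift _ _ _ _ (mA i)).
by rewrite tnth_mktuple mulr0 addr0.
Qed.

Section move_record.
Variables (p : nat) (i j : 'I_p) (theta : p.-tuple R) (b : {posnum R}).
Hypothesis neq_ij : i != j.

(** The minus sign at [i] is the reflection of the cell that loses a record: [delta = (1, 1)]
    encodes a record that goes from cell [i] to cell [j], and [(0, 0)] no change. *)
Definition moved (delta : 2.-tuple R) : p.-tuple R :=
  [tuple if k == i then tnth theta i - tnth delta ord0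
         else if k == j then tnth theta j + tnth delta ord_max
         else tnth theta k | k < p]%R.

(** A randomized map from pairs to full vectors: [z.1] fills the cells [i] (reflected) and [j], and
    an independent vector [z.2] fills the others. *)
Let embed (z : 2.-tuple mR * p.-tuple mR) : p.-tuple mR :=
  [tuple if k == i then signed_shift true (tnth theta i) (tnth z.1 ord0)
         else if k == j then signed_shift false (tnth theta j) (tnth z.1 ord_max)
         else tnth z.2 k | k < p].

Let measurable_embed : measurable_fun [set: 2.-tuple mR * p.-tuple mR] embed.
Proof.
apply/measurable_fun_tnthP => k.
rewrite (_ : _ \o _ = fun z => if k == i then
    signed_shift true (tnth theta i) (tnth z.1 ord0) else if k == j then
    signed_shift false (tnth theta j) (tnth z.1 ord_max) else tnth z.2 k);
  last by apply/funext => z /=; rewrite tnth_mktuple.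
case: (k == i); [|case: (k == j)].
- exact: measurableT_comp (measurable_signed_shift _ _)
    (measurableT_comp (@measurable_tnth _ mR 2 ord0) measurable_fst).
- exact: measurableT_comp (measurable_signed_shift _ _)
    (measurableT_comp (@measurable_tnth _ mR 2 ord_max) measurable_fst).
- exact: measurableT_comp (@measurable_tnth _ mR p k) measurable_snd.
Qed.

(** Reads the cells [i] and [j] and undoes the reflection and the shift of [embed]. *)
Let project (y : p.-tuple mR) : 2.-tuple mR :=
  [tuple signed_shift true (tnth theta i) (tnth y i);
         signed_shift false (- tnth theta j) (tnth y j)].

Let measurable_project : measurable_fun [set: p.-tuple mR] project.
Proof.
apply: measurable_cons; last apply: measurable_cons => //.
- by apply: measurableT_comp => //; exact: measurable_tnth.
- by apply: measurableT_comp => //; exact: measurable_tnth.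
Qed.

HB.instance Definition _ := isMeasurableFun.Build _ _ _ _ embed measurable_embed.

HB.instance Definition _ :=
  isMeasurableFun.Build _ _ _ _ project measurable_project.

Let embed_law delta (B : set (p.-tuple mR)) : measurable B ->
  laplace_vec (moved delta) b B =
  (laplace_vec delta b \x laplace_vec theta b) (embed @^-1` B).
Proof.
move=> mB; apply/esym; rewrite -[LHS]/(distribution
  (laplace_vec delta b \x laplace_vec theta b) embed B).
move: B mB; apply: prod_prob_unique => A mA.
(* The preimage of a box under [embed] is [box A2] times [box Ap]; the sides [i] and [j] of [Ap] are
   full because [embed] discards these coordinates of [z.2]. *)
pose A2 (k : 'I_2) := if k == ord0 then signed_shift true (tnth theta i) @^-1` A i
  else signed_shift false (tnth theta j) @^-1` A j.
pose Ap (k : 'I_p) := if (k == i) || (k == j) then setT else A k.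
have mA2 k : measurable (A2 k).
  by rewrite /A2; case: ifP => _; exact: measurable_signed_shift_preimage.
have mAp k : measurable (Ap k) by rewrite /Ap; case: ifP.
transitivity ((laplace_vec delta b \x laplace_vec theta b) (box A2 `*` box Ap)).
  congr ((_ \x _) _); apply/seteqP.
  have embedE x z k : tnth (embed (x, z)) k =
      if k == i then signed_shift true (tnth theta i) (tnth x ord0)
      else if k == j then signed_shift false (tnth theta j) (tnth x ord_max)
      else tnth z k by rewrite tnth_mktuple.
  split => -[x z] /=.
    move=> Axz; split.
      apply/forall_ord2; rewrite /A2 /=; split.
        by have := Axz i; rewrite embedE eqxx.
      by have := Axz j; rewrite embedE eq_sym (negbTE neq_ij) eqxx.
    move=> k; rewrite /Ap; have := Axz k; rewrite embedE.
    by case: (k == i) => //; case: (k == j).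
  move=> [/forall_ord2 [Ai Aj] Az] k; rewrite embedE.
  have := Az k; rewrite /Ap; case: eqP => [->//|_]; case: eqP => [->//|_] //=.
rewrite product_measure1E; [|exact: measurable_box|exact: measurable_box].
rewrite [X in X * _]prod_prob_box// [X in _ * X]prod_prob_box//.
rewrite big_ord_recr big_ord1 /=.
rewrite (_ : widen_ord _ _ = ord0); last exact: val_inj.
rewrite [RHS](prode_D2 _ neq_ij) [X in _ * X = _](prode_D2 _ neq_ij).
have -> : Ap i = setT by rewrite /Ap eqxx.
have -> : Ap j = setT by rewrite /Ap eqxx orbT.
have Ai : laplace_prob (tnth delta ord0) b (A2 ord0) =
    laplace_prob (tnth (moved delta) i) b (A i).
  rewrite /A2 /= (laplace_prob_signed_shift _ _ _ _ (mA i)) tnth_mktuple eqxx expr1.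
  by rewrite mulN1r.
have Aj : laplace_prob (tnth delta ord_max) b (A2 ord_max) =
    laplace_prob (tnth (moved delta) j) b (A j).
  rewrite /A2 /= (laplace_prob_signed_shift _ _ _ _ (mA j)) tnth_mktuple eq_sym.
  by rewrite (negbTE neq_ij) eqxx expr0 mul1r.
rewrite -Ai -Aj !probability_setT !mul1e; congr (_ * _).
apply: eq_bigr => k /andP[/negbTE ki /negbTE kj].
by rewrite /Ap tnth_mktuple ki kj.
Qed.

Let project_law delta (B : set (2.-tuple mR)) : measurable B ->
  laplace_vec delta b B = laplace_vec (moved delta) b (project @^-1` B).
Proof.
move=> mB; apply/esym; rewrite -[LHS]/(distribution
  (laplace_vec (moved delta) b) project B).
move: B mB; apply: prod_prob_unique => A mA.
pose Ap (k : 'I_p) : set mR :=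
  if k == i then signed_shift true (tnth theta i) @^-1` A ord0
  else if k == j then signed_shift false (- tnth theta j) @^-1` A ord_max
  else setT.
have mAp k : measurable (Ap k).
  rewrite /Ap; case: ifP => _; first exact: measurable_signed_shift_preimage.
  by case: ifP => _ //; exact: measurable_signed_shift_preimage.
transitivity (laplace_vec (moved delta) b (box Ap)).
  congr (laplace_vec _ b _); apply/seteqP; split => y /=.
    move=> /forall_ord2 [A0 A1] k; rewrite /Ap.
    by case: eqP => [->//|_]; case: eqP => [->//|_].
  move=> Ay; apply/forall_ord2; split.
    by have := Ay i; rewrite /Ap eqxx.
  by have := Ay j; rewrite /Ap eq_sym (negbTE neq_ij) eqxx.
rewrite [LHS]prod_prob_box// [RHS]big_ord_recr big_ord1 /=.
rewrite (_ : widen_ord _ _ = ord0); last exact: val_inj.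
have Ai : laplace_prob (tnth (moved delta) i) b (Ap i) =
    laplace_prob (tnth delta ord0) b (A ord0).
  rewrite /Ap eqxx (laplace_prob_signed_shift _ _ _ _ (mA ord0)) tnth_mktuple eqxx.
  by rewrite expr1 mulN1r opprB addrC subrK.
have Aj : laplace_prob (tnth (moved delta) j) b (Ap j) =
    laplace_prob (tnth delta ord_max) b (A ord_max).
  rewrite /Ap eq_sym (negbTE neq_ij) eqxx.
  rewrite (laplace_prob_signed_shift _ _ _ _ (mA ord_max)) tnth_mktuple.
  by rewrite eq_sym (negbTE neq_ij) eqxx expr0 mul1r addKr.
rewrite (prode_D2 _ neq_ij) Ai Aj big1 ?mule1// => k /andP[/negbTE ki /negbTE kj].
by rewrite /Ap ki kj probability_setT.
Qed.

(** [project] and [embed] carry each pair of laws to the other, so data processing applies in both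
    directions. *)
Lemma tradeoff_moved delta delta' alpha :
  tradeoff (laplace_vec (moved delta) b) (laplace_vec (moved delta') b) alpha =
  tradeoff (laplace_vec delta b) (laplace_vec delta' b) alpha.
Proof.
apply/eqP; rewrite eq_le; apply/andP; split.
  by apply: (@tradeoff_map _ _ _ _ _ _ _ project); exact: project_law.
by apply: (@tradeoff_garble _ _ _ _ _ _ _ _ _ (laplace_vec theta b) embed);
  exact: embed_law.
Qed.

End move_record.

End laplace_vectors.

(** * Monotonicity in the scale, and domination between Laplace laws *)

Section freq_monotone.
Local Open Scope ereal_scope.
Context {R : realType}.
Local Notation mR := (measurableTypeR R).

Section add.
Variable p : nat.

Let add (z : p.-tuple mR * p.-tuple mR) : p.-tuple mR :=
  [tuple ((tnth z.1 k : R) + (tnth z.2 k : R))%R | k < p].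

Let measurable_add : measurable_fun [set: p.-tuple mR * p.-tuple mR] add.
Proof.
apply/measurable_fun_tnthP => k.
rewrite (_ : _ \o _ = fun z : p.-tuple mR * p.-tuple mR =>
    ((tnth z.1 k : R) + (tnth z.2 k : R))%R); last first.
  by apply/funext => z /=; rewrite tnth_mktuple.
apply: measurable_funD.
- exact: measurableT_comp (@measurable_tnth _ mR p k) measurable_fst.
- exact: measurableT_comp (@measurable_tnth _ mR p k) measurable_snd.
Qed.

HB.instance Definition _ := isMeasurableFun.Build _ _ _ _ add measurable_add.

(** Independent copies of the noise of [laplace_prob_add_noise] are added to the coordinates; their
    law is the same for [delta] and [delta'], so this is a garbling. *)
Lemma tradeoff_laplace_vec_mono (delta delta' : p.-tuple R) (b b' : {posnum R})
    (alpha : R) : (b%:num < b'%:num)%R ->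
  tradeoff (laplace_vec delta b) (laplace_vec delta' b) alpha <=
  tradeoff (laplace_vec delta b') (laplace_vec delta' b') alpha.
Proof.
move=> bb'; have [nu nuE] := laplace_prob_add_noise bb'.
pose N := prod_prob (fun _ : 'I_p => nu).
have law (a : p.-tuple R) (B : set (p.-tuple mR)) : measurable B ->
    laplace_vec a b' B = (laplace_vec a b \x N) (add @^-1` B).
  move=> mB; apply/esym.
  rewrite -[LHS]/(distribution (laplace_vec a b \x N) add B).
  move: B mB; apply: prod_prob_unique => A mA.
  pose E k : set (mR * mR) := [set z | A k ((z.1 : R) + (z.2 : R))%R].
  have mE k : measurable (E k).
    rewrite -[X in measurable X]setTI.
    have : measurable_fun [set: mR * mR] (fun z => (z.1 : R) + (z.2 : R) : mR)%R.
      by apply: measurable_funD; [exact: measurable_fst|exact: measurable_snd].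
    by apply.
  rewrite /distribution /pushforward /product_measure1.
  (* For fixed [x] the event is a box of sections, so its probability is a product over coordinates
     and [integral_prod_prob] splits the outer integral. *)
  transitivity (\int[laplace_vec a b]_x
      \prod_(k < p) nu (xsection (E k) (tnth x k))).
    apply: eq_integral => x _.
    transitivity (N (box (fun k => xsection (E k) (tnth x k)))).
      rewrite -[LHS]/(N (xsection (add @^-1` box A) x)).
      congr (N _); apply/seteqP; rewrite /xsection; split => z.
        move=> /set_mem Az k; apply: mem_set; have := Az k.
        by rewrite tnth_mktuple.
      move=> Az; apply: mem_set => k; have /set_mem := Az k.
      by rewrite /E /= tnth_mktuple.
    by rewrite [LHS]prod_prob_box// => k; exact: measurable_xsection.
  rewrite [LHS](@integral_prod_prob _ _ _ _ _ (fun k t => nu (xsection (E k) t))).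
  - by apply: eq_bigr => k _; exact: nuE.
  - by move=> k; exact: measurable_fun_xsection.
  - by [].
by apply: (@tradeoff_garble _ _ _ _ _ _ _ _ _ N add); exact: law.
Qed.

End add.

Section density_bounds.
Implicit Types (b : {posnum R}).

(** The normalizing constants have ratio exactly [b / b'], and the exponential factor grows with the
    scale. *)
Lemma laplace_prob_scale_le (a : R) b b' A : (b%:num <= b'%:num)%R ->
  measurable A ->
  (b%:num / b'%:num)%:E * laplace_prob a b A <= laplace_prob a b' A.
Proof.
move=> bb' mA; rewrite /laplace_prob.
have mf r : measurable_fun A (fun x => (laplace_pdf a r x)%:E).
  by apply/measurable_funTS/measurable_EFinP; exact: measurable_laplace_pdf.
have f0 r y : 0 <= (laplace_pdf a r y)%:E by rewrite lee_fin laplace_pdf_ge0.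
rewrite -ge0_integralZl//; apply: ge0_le_integral => //.
- by move=> x _; apply: mule_ge0.
- exact: emeasurable_funM.
move=> x _; rewrite -EFinM lee_fin /laplace_pdf mulrA.
rewrite (_ : b%:num / b'%:num / (2 * b%:num) = (2 * b'%:num)^-1)%R; last first.
  by field; rewrite !gt_eqF.
rewrite ler_wpM2l// ler_expR !mulNr lerN2; apply: ler_wpM2l => //.
by rewrite lef_pV2 ?posrE.
Qed.

(** Triangle inequality in the exponent. *)
Lemma laplace_prob_location_le (a a' : R) b A : measurable A ->
  (expR (- (`|a - a'| / b%:num)))%:E * laplace_prob a b A <= laplace_prob a' b A.
Proof.
move=> mA; rewrite /laplace_prob.
have mf r : measurable_fun A (fun x => (laplace_pdf r b x)%:E).
  by apply/measurable_funTS/measurable_EFinP; exact: measurable_laplace_pdf.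
have f0 r y : 0 <= (laplace_pdf r b y)%:E by rewrite lee_fin laplace_pdf_ge0.
rewrite -ge0_integralZl//.
apply: ge0_le_integral => //.
- by move=> x _; apply: mule_ge0.
- exact: emeasurable_funM.
move=> x _; rewrite -EFinM lee_fin /laplace_pdf mulrCA ler_wpM2l//.
rewrite -expRD ler_expR !mulNr -opprD lerN2 -mulrDl ler_wpM2r//.
by rewrite [leRHS]addrC ler_distD.
Qed.

End density_bounds.

End freq_monotone.

(** * Passage to the limit as the scale decreases *)

Section test_operations.
Local Open Scope ereal_scope.
Context d (T : measurableType d) (R : realType) (phi : {mfun T >-> R}).
Hypothesis phi01 : is_test phi.

Lemma test_scale (t : R) : (0 <= t <= 1)%R ->
  exists2 psi : {mfun T >-> R}, is_test psi &
    forall P : probability T R, 'E_P[psi] = t%:E * 'E_P[phi].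
Proof.
move=> /andP[t0 t1].
have mpsi : measurable_fun [set: T] (fun x => t * phi x)%R.
  by apply: measurable_funM.
pose psi : {mfun T >-> R} := HB.pack (fun x => t * phi x)%R
  (isMeasurableFun.Build _ _ _ _ _ mpsi).
exists psi => [x|P].
  by rewrite /= mulr_ge0 ?mulr_ile1//; have /andP[] := phi01 x.
rewrite !expectation_def -ge0_integralZl//.
- exact/measurable_EFinP.
- by move=> x _; rewrite lee_fin; have /andP[] := phi01 x.
Qed.

Lemma test_onem : exists2 psi : {mfun T >-> R}, is_test psi &
  forall P : probability T R, 'E_P[phi] + 'E_P[psi] = 1.
Proof.
have mpsi : measurable_fun [set: T] (fun x => 1 - phi x)%R.
  by apply: measurable_funB.
pose psi : {mfun T >-> R} := HB.pack (fun x => 1 - phi x)%R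
  (isMeasurableFun.Build _ _ _ _ _ mpsi).
exists psi => [x|P].
  by rewrite /= subr_ge0 lerBlDr lerDl andbC phi01.
rewrite !expectation_def -ge0_integralD//.
- under eq_integral do rewrite -EFinD addrC subrK.
  by rewrite integral_cst// mul1e; exact: probability_setT.
- by move=> x _; rewrite lee_fin; have /andP[] := phi01 x.
- exact/measurable_EFinP.
- by move=> x _; rewrite lee_fin subr_ge0; have /andP[] := phi01 x.
- exact/measurable_EFinP.
Qed.

End test_operations.

Section right_closed.
Local Open Scope ereal_scope.
Context {R : realType} (p : nat) (delta delta' : p.-tuple R) (b : {posnum R}).
Local Notation mR := (measurableTypeR R).
Implicit Types phi : {mfun p.-tuple mR >-> R}.

(** Here [s] is the ratio [b / b'], paid once per coordinate. *)
Let expectation_scale_le (a : p.-tuple R) (s : R) b' phi :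
  is_test phi -> (0 <= s)%R -> (b%:num = s * b'%:num)%R -> (s <= 1)%R ->
  (s ^+ p)%:E * 'E_(laplace_vec a b)[phi] <= 'E_(laplace_vec a b')[phi].
Proof.
move=> t s0 bE s1.
apply: (ge0_le_expectation (c := NngNum (exprn_ge0 p s0))) => // A mA.
apply: (prod_prob_le (c := NngNum s0)) => // i B mB /=.
have -> : s = (b%:num / b'%:num)%R by rewrite bE mulfK// gt_eqF.
by apply: laplace_prob_scale_le => //; rewrite bE ler_piMl.
Qed.

Let expectation_location_eq0 phi : is_test phi ->
  'E_(laplace_vec delta b)[phi] = 0 -> 'E_(laplace_vec delta' b)[phi] = 0.
Proof.
(* The sum [D] bounds the shift of every coordinate, so that one positive factor [c] serves them
   all. *)
move=> t E0; pose D := (\sum_k `|tnth delta' k - tnth delta k|)%R.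
pose c : {nonneg R} := NngNum (expR_ge0 (- (D / b%:num))).
have : (c%:num ^+ p)%:E * 'E_(laplace_vec delta' b)[phi] <=
    'E_(laplace_vec delta b)[phi].
  apply: (ge0_le_expectation (c := NngNum (exprn_ge0 p (ge0 c)))) => // A mA.
  apply: (prod_prob_le (c := c)) => // i B mB.
  apply: le_trans (@laplace_prob_location_le R (tnth delta' i) _ b B mB).
  rewrite lee_wpmul2r// lee_fin ler_expR lerN2 ler_wpM2r//.
  by rewrite /D (bigD1 i)//= lerDl sumr_ge0.
rewrite E0 => E0'; apply/eqP; rewrite eq_le.
have [x /andP[x0 _] xE] := expectation_test (laplace_vec delta' b) t.
move: E0'; rewrite xE -EFinM !lee_fin x0 andbT pmulr_rle0// exprn_gt0//.
by rewrite expR_gt0.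
Qed.

Lemma tradeoff_laplace_vec_right_closed (alpha : R) (x : \bar R) :
  (0 <= alpha <= 1)%R -> x <= 1 ->
  (forall b' : {posnum R}, (b%:num < b'%:num)%R ->
    x <= tradeoff (laplace_vec delta b') (laplace_vec delta' b') alpha) ->
  x <= tradeoff (laplace_vec delta b) (laplace_vec delta' b) alpha.
Proof.
move=> /andP[a0 a1] x1 xle; apply: le_ereal_inf_tmp => _ [phi [t phia] <-].
have [u /andP[u0 u1] uE] := expectation_test (laplace_vec delta b) t.
have [v /andP[v0 v1] vE] := expectation_test (laplace_vec delta' b) t.
move: phia; rewrite vE uE lee_fin => ua.
(* At [alpha = 0] no rescaling can restore the level, but the power of [phi] is then 0 as well and
   [x <= 1] concludes. *)
have [a_eq0|a_neq0] := eqVneq alpha 0%R.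
  have u_eq0 : u = 0%R by apply/eqP; rewrite eq_le u0 andbT -a_eq0.
  by move: vE; rewrite expectation_location_eq0// ?uE ?u_eq0// => <-; rewrite sube0.
have {a_neq0}a_gt0 : (0 < alpha)%R by rewrite lt_neqAle eq_sym a_neq0.
(* At scale b / s the level of phi is at most beta := 1 - s^p + s^p alpha, and
   phi * alpha / beta is a test of level alpha. *)
have key (s : R) : (0 < s < 1)%R ->
    x <= (1 - alpha / (1 - s ^+ p + s ^+ p * alpha) * (s ^+ p * v))%:E.
  move=> /andP[s0 s1]; set q := (s ^+ p)%R.
  have q0 : (0 <= q)%R by rewrite exprn_ge0// ltW.
  have q1 : (q <= 1)%R by rewrite exprn_ile1// ltW.
  have [b' b'E] : exists b' : {posnum R}, b'%:num = (b%:num / s)%R.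
    have bs0 : (0 < b%:num / s)%R by rewrite divr_gt0.
    by exists (PosNum bs0).
  have bE : (b%:num = s * b'%:num)%R by rewrite b'E mulrC divfK// gt_eqF.
  have le_q (a : p.-tuple R) f : is_test f ->
      q%:E * 'E_(laplace_vec a b)[f] <= 'E_(laplace_vec a b')[f].
    by move=> tf; apply: expectation_scale_le bE _ => //; exact: ltW.
  set beta := (1 - q + q * alpha)%R.
  have beta_ge : (alpha <= beta)%R by rewrite /beta; nra.
  have beta0 : (0 < beta)%R by apply: lt_le_trans beta_ge.
  have t01 : (0 <= alpha / beta <= 1)%R.
    by rewrite divr_ge0 ?(ltW beta0)//= ler_pdivrMr// mul1r.
  have [u' /andP[u'0 u'1] u'E] := expectation_test (laplace_vec delta b') t.
  have [v' /andP[v'0 v'1] v'E] := expectation_test (laplace_vec delta' b') t.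
  (* Domination gives only lower bounds; applied to the complementary test it bounds the level of
     [phi] from above. *)
  have u'beta : (u' <= beta)%R.
    have [psi tpsi psiE] := test_onem t.
    have [w _ wE] := expectation_test (laplace_vec delta b) tpsi.
    have [w' _ w'E] := expectation_test (laplace_vec delta b') tpsi.
    have := psiE (laplace_vec delta b); rewrite uE wE -EFinD => -[uw].
    have := psiE (laplace_vec delta b'); rewrite u'E w'E -EFinD => -[uw'].
    have := le_q delta _ tpsi; rewrite wE w'E -EFinM lee_fin.
    by rewrite /beta; nra.
  have [psi tpsi psiE] := test_scale t t01.
  apply: (le_trans (xle b' _)).
    by rewrite b'E ltr_pdivlMr// gtr_pMr.
  apply: (le_trans (tradeoff_le _ tpsi _)).
    rewrite psiE u'E -EFinM lee_fin mulrAC ler_pdivrMr//.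
    by rewrite ler_wpM2l.
  rewrite psiE v'E -EFinM -EFinB lee_fin lerD2l lerN2 ler_wpM2l//.
    by have /andP[] := t01.
  by have := le_q delta' _ t; rewrite vE v'E -EFinM lee_fin.
apply/lee_addgt0Pr => e e0; rewrite -EFinB -EFinD.
have bernoulli n (s : R) : (0 <= s <= 1)%R -> (1 - s ^+ n <= n%:R * (1 - s))%R.
  move=> /andP[s0 s1]; elim: n => [|n IH]; first by rewrite expr0 mul0r subrr.
  have : (0 <= s ^+ n <= 1)%R by rewrite exprn_ge0//= exprn_ile1.
  by rewrite exprS -natr1; nra.
(* With [s = 1 - m], Bernoulli gives [1 - s^p <= p * m <= alpha * e]. The bound [1 / 2] keeps [s]
   inside []0, 1[], and [p.+1] keeps the denominator positive. *)
pose m := Num.min (2^-1)%R (alpha * e / p.+1%:R)%R.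
have m0 : (0 < m)%R by rewrite lt_min invr_gt0 ltr0n divr_gt0 ?mulr_gt0 ?ltr0n.
have m2 : (m <= 2^-1)%R by rewrite ge_min lexx.
have me : (p%:R * m <= alpha * e)%R.
  have : (m <= alpha * e / p.+1%:R)%R by rewrite ge_min lexx orbT.
  rewrite ler_pdivlMr ?ltr0n// -natr1; nra.
have s01 : (0 < 1 - m < 1)%R by apply/andP; split; lra.
apply: le_trans (key _ s01) _; rewrite lee_fin.
set q := ((1 - m) ^+ p)%R; set beta := (1 - q + q * alpha)%R.
have qe : (1 - q <= alpha * e)%R.
  apply: le_trans (bernoulli p (1 - m)%R _) _; first by apply/andP; split; lra.
  by rewrite opprB addrCA subrr addr0.
have q0 : (0 <= q)%R by rewrite exprn_ge0//; lra.
have q1 : (q <= 1)%R by rewrite exprn_ile1//; lra.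
have beta_ge : (alpha <= beta)%R by rewrite /beta; nra.
have beta0 : (0 < beta)%R by apply: lt_le_trans beta_ge.
(* Multiplied by [beta], this reads [1 - q <= e * beta], which follows from [qe] and
   [alpha <= beta]. *)
have wq : (1 - alpha / beta * q <= e)%R.
  rewrite -(ler_pM2r beta0) mulrBl mul1r mulrAC divfK ?gt_eqF//.
  by move: beta_ge; rewrite /beta; nra.
by rewrite mulrA; nra.
Qed.

End right_closed.

(** * Frequency tables of neighboring datasets *)

Section frequency_table.
Context {R : realType} (X : Type) (n p : nat) (C : 'I_p -> set X).
Hypothesis C_partition : partition [set: 'I_p] C [set: X].
Implicit Types S : n.-tuple X.
Local Notation theta := (@freq_table R X n p C).

Let category x : exists i, x \in C i.
Proof.
have [CT _ _] := C_partition; have : [set: X] x by [].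
by rewrite -CT => -[i _ Cx]; exists i; rewrite inE.
Qed.

Let mem_category x i k : x \in C i -> (x \in C k) = (k == i).
Proof.
have [_ /trivIsetP tC _] := C_partition => xi.
have [->//|ki] := eqVneq; apply/negbTE/negP => xk.
have /disjoints_subset/(_ x (set_mem xk)) := tC k i I I ki.
by apply; exact: set_mem.
Qed.

(** Written with sums on both sides, since subtraction of natural numbers truncates. *)
Let count_neighbors (a : pred X) S S' j :
  (forall k, k != j -> tnth S k = tnth S' k) ->
  (count a S + a (tnth S' j) = count a S' + a (tnth S j))%N.
Proof.
have countE (U : n.-tuple X) : count a U = (\sum_(k < n) a (tnth U k))%N.
  by rewrite -sum1_count big_mkcond big_tuple; apply: eq_bigr => k _; case: (a _).
move=> SS'; rewrite !countE (bigD1 j)//= [in RHS](bigD1 j)//=.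
rewrite [in LHS](eq_bigr (fun k => a (tnth S' k) : nat)); last first.
  by move=> k kj; rewrite SS'.
by rewrite addnC addnA addnAC.
Qed.

Let theta_neighbors S S' j i i' : (forall k, k != j -> tnth S k = tnth S' k) ->
  tnth S j \in C i -> tnth S' j \in C i' ->
  forall k, tnth (theta S') k = tnth (theta S) k - (k == i)%:R + (k == i')%:R.
Proof.
move=> SS' Si S'i' k; rewrite !tnth_mktuple.
have /(congr1 (fun m => m%:R : R)) := count_neighbors (fun x => x \in C k) SS'.
rewrite !natrD (mem_category k Si) (mem_category k S'i') => h.
by rewrite addrAC h addrK.
Qed.

(** Both tables are expressed from the same base [theta S], which is the form that [tradeoff_moved]
    takes. *)
Lemma theta_moved S S' j i i' : (forall k, k != j -> tnth S k = tnth S' k) ->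
  tnth S j \in C i -> tnth S' j \in C i' -> i != i' ->
  theta S = moved i i' (theta S) [tuple 0; 0] /\
  theta S' = moved i i' (theta S) [tuple 1; 1].
Proof.
move=> SS' Si S'i' ii'.
have constE (x : R) (k : 'I_2) : tnth [tuple x; x] k = x.
  by case: k => -[|[|//]].
split; apply: eq_from_tnth => k; rewrite [RHS]tnth_mktuple !constE.
  by rewrite subr0 addr0; case: eqP => [->//|_]; case: eqP => [->|].
rewrite (theta_neighbors SS' Si S'i').
have [->|_] := eqVneq k i; first by rewrite (negbTE ii') addr0.
by case: eqVneq => [->|_]; rewrite subr0// addr0.
Qed.

Lemma theta_same S S' j i : (forall k, k != j -> tnth S k = tnth S' k) ->
  tnth S j \in C i -> tnth S' j \in C i -> theta S = theta S'.
Proof.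
move=> SS' Si S'i; apply: eq_from_tnth => k.
by rewrite (theta_neighbors SS' Si S'i) subrK.
Qed.

Lemma tradeoff_mechanism S S' j i i' (b : {posnum R}) (alpha : R) :
  (forall k, k != j -> tnth S k = tnth S' k) ->
  tnth S j \in C i -> tnth S' j \in C i' -> i != i' ->
  tradeoff (laplace_mechanism theta b S) (laplace_mechanism theta b S') alpha =
  freq_tradeoff b alpha.
Proof.
move=> SS' Si S'i' ii'; have [E0 E1] := theta_moved SS' Si S'i' ii'.
rewrite /freq_tradeoff -(tradeoff_moved (theta S) b ii') -E0 -E1.
by apply: eq_tradeoff => A mA; exact: laplace_mechanismE.
Qed.

Lemma gdp_freq_tradeoff (mu : R) (b : {posnum R}) : (1 <= n)%N -> (2 <= p)%N ->
  is_gdp mu (laplace_mechanism theta b) <->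
  tradeoff_ge (freq_tradeoff b) (gauss_tradeoff mu).
Proof.
move=> n1 p2; split => gdp alpha a01.
  (* A pair that changes cell: all records equal [x] in the first category, except that record [j]
     of [S'] is some [y] in the second. *)
  pose i0 := Ordinal (ltnW p2); pose i1 := Ordinal p2; pose j := Ordinal n1.
  have [_ _ C0] := C_partition.
  have [x Cx] := C0 i0 I; have [y Cy] := C0 i1 I.
  have i01 : i0 != i1 by [].
  pose S : n.-tuple X := [tuple x | _ < n].
  pose S' : n.-tuple X := [tuple if k == j then y else x | k < n].
  have SS' k : k != j -> tnth S k = tnth S' k.
    by move=> kj; rewrite !tnth_mktuple (negbTE kj).
  have Sj : tnth S j = x by rewrite tnth_mktuple.
  have S'j : tnth S' j = y by rewrite tnth_mktuple eqxx.
  have Sj_in : tnth S j \in C i0 by rewrite Sj; exact: mem_set.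
  have S'j_in : tnth S' j \in C i1 by rewrite S'j; exact: mem_set.
  apply: (le_trans (gdp alpha a01)); apply: ereal_inf_lbound.
  exists (S, S'); last exact: tradeoff_mechanism SS' Sj_in S'j_in i01.
  exists j; split => //= SS'j; move: (mem_category i1 Sj_in).
  by rewrite SS'j S'j_in eq_sym (negbTE i01).
apply: le_ereal_inf_tmp => _ [[S S'] [j [_ SS']] <-] /=.
have [i Si] := category (tnth S j); have [i' S'i'] := category (tnth S' j).
have [ii'|ii'] := eqVneq i i'; last first.
  by rewrite (tradeoff_mechanism _ _ SS' Si S'i' ii'); exact: gdp.
(* A change within one category leaves the table, hence the law, unchanged: every test of level
   [alpha] has power at most [alpha], while the constant test gives [G_mu(alpha) <= 1 - alpha]. *)
rewrite -ii' in S'i'; rewrite /laplace_mechanism (theta_same SS' Si S'i').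
apply: (le_trans (tradeoff_onem _ _ a01)).
apply: le_ereal_inf_tmp => _ [phi [_ phia] <-].
exact: leeB.
Qed.

End frequency_table.

(** * The admissible scales form a closed up-set *)

Lemma b_tilde_le {R : realType} (mu : R) (b : {posnum R}) :
  (b_tilde mu <= b%:num%:E)%E <->
  tradeoff_ge (freq_tradeoff b) (gauss_tradeoff mu).
Proof.
split=> [bb|fb]; last by apply: ereal_inf_lbound; exists b.
(* Since [b] may equal the infimum, it is approached from above: below each [b' > b] lies an
   admissible [b0], and monotonicity carries the bound from [b0] to [b']. *)
move=> alpha a01; apply: tradeoff_laplace_vec_right_closed => //.
  apply: (le_trans (tradeoff_onem _ _ a01)).
  by rewrite -EFinB lee_fin gerBl; case/andP: a01.
move=> b' bb'; have : (b_tilde mu < b'%:num%:E)%E.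
  by apply: le_lt_trans bb _; rewrite lte_fin.
move=> /ereal_inf_lt [_ [b0 /= fb0 <-]]; rewrite lte_fin => b0b'.
by apply: (le_trans (fb0 alpha a01)); exact: tradeoff_laplace_vec_mono.
Qed.

Theorem theorem14 (R : realType) (X : Type) (n p : nat) (C : 'I_p -> set X)
    (mu : R) (b : {posnum R}) :
  (1 <= n)%N -> (2 <= p)%N ->
  partition [set: 'I_p] C [set: X] ->
  0 < mu ->
  is_gdp mu (laplace_mechanism (freq_table (n := n) C) b) <->
  (b_tilde mu <= b%:num%:E)%E.
Proof.
move=> n1 p2 partC _; apply: (iff_trans (gdp_freq_tradeoff partC mu b n1 p2)).
by apply: iff_sym; exact: b_tilde_le.
Qed.
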